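(* For all $n\in\mathbb{N}$, $F_{\mathbb{N}}=\Theta\Lambda_n=\{\gamma_1\gamma_2:\gamma_1\in\Theta,\ \gamma_2\in\Lambda_n\}$.
   Context: $\mathbb{N}=\{1,2,3,\ldots\}$. The zig-zag order $\preceq$ on $\mathbb{N}$ is the partial order consisting of the diagonal together with the relation $\prec$ defined, for each $n\in\mathbb{N}$, by $n\prec n+1$ if $n$ is odd and $n+1\prec n$ if $n$ is even. $F_{\mathbb{N}}$ is the semigroup, under composition, of all maps $\alpha:\mathbb{N}\to\mathbb{N}$ such that $x\preceq y$ implies $x\alpha\preceq y\alpha$. Maps are written on the right, so $x(\alpha\beta)=(x\alpha)\beta$. A non-empty subset of $\mathbb{N}$ is convex if it is an interval (possibly infinite) with respect to the usual order $\le$. $\Theta:=\{\alpha\in F_{\mathbb{N}}: a\alpha^{-1}\text{ is a convex set for all }a\in\mathrm{im}\,\alpha\}$. For $\alpha\in F_{\mathbb{N}}$, $\mathrm{nb}(\alpha):=\{a\in\mathbb{N}: a\alpha=(a+1)\alpha\}$ and $\mathrm{c}(\alpha):=\left|\bigcup\{a\alpha^{-1}: a\in\mathrm{im}\,\alpha,\ |a\alpha^{-1}|\ge 2\}\right|$. For $n\in\mathbb{N}$, $\Lambda_n:=\{\alpha\in F_{\mathbb{N}}: |\mathrm{nb}(\alpha)|=0,\ \mathrm{c}(\alpha)>0,\ 1\alpha\ge n,\ |\{1,2,\ldots,n\}\alpha|=n\}$. *)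

(* Defs.v *)
From mathcomp Require Import all_boot.
From mathcomp Require Import boolp classical_sets functions cardinality.

Set Implicit Arguments.
Unset Strict Implicit.
Unset Printing Implicit Defensive.

Local Open Scope classical_set_scope.
Local Open Scope card_scope.

(* The natural numbers start at 1. The zig-zag order depends on parity, so the
   values are kept (a subtype of nat) instead of being shifted by one. *)
Definition posnat : Type := {n : nat | 0 < n}.

Definition posnat1 : posnat := exist (fun n => 0 < n) 1 isT.

Definition posnatS (n : posnat) : posnat := exist (fun n => 0 < n) (val n).+1 isT.

Inductive zz_lt : posnat -> posnat -> Prop :=
| zz_lt_up (n : posnat) : odd (val n) -> zz_lt n (posnatS n)
| zz_lt_down (n : posnat) : ~~ odd (val n) -> zz_lt (posnatS n) n.

Definition zz_le (x y : posnat) : Prop := x = y \/ zz_lt x y.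

Definition FN : set (posnat -> posnat) :=
  [set alpha | forall x y, zz_le x y -> zz_le (alpha x) (alpha y)].

(* Maps act on the right: x (alpha beta) = (x alpha) beta. *)
Definition rcomp (alpha beta : posnat -> posnat) : posnat -> posnat := beta \o alpha.

Definition setprod (A B : set (posnat -> posnat)) : set (posnat -> posnat) :=
  [set rcomp alpha beta | alpha in A & beta in B].

Definition convexN (A : set posnat) : Prop :=
  A !=set0 /\
  forall x y z : posnat, A x -> A z -> val x <= val y <= val z -> A y.

Definition fiber (alpha : posnat -> posnat) (a : posnat) : set posnat :=
  alpha @^-1` [set a].

Definition Theta : set (posnat -> posnat) :=
  [set alpha | FN alpha /\ forall a, range alpha a -> convexN (fiber alpha a)].

Definition nb (alpha : posnat -> posnat) : set posnat :=
  [set a | alpha a = alpha (posnatS a)].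

(* The cardinal c(alpha), possibly infinite, is that of the set below;
   comparisons with it are stated with card_le and card_eq. *)
Definition cset (alpha : posnat -> posnat) : set posnat :=
  \bigcup_(a in [set a | range alpha a /\ `I_2 #<= fiber alpha a])
    fiber alpha a.

Definition initseg (n : posnat) : set posnat := [set x | val x <= val n].

(* ~~ (A #<= `I_0) says |A| > 0. *)
Definition Lambda (n : posnat) : set (posnat -> posnat) :=
  [set alpha | [/\ FN alpha,
                   nb alpha #= `I_0,
                   ~~ (cset alpha #<= `I_0),
                   val n <= val (alpha posnat1)
                 & alpha @` initseg n #= `I_(val n)]].

(* Main.v *)
Require Import Defs.
From mathcomp Require Import all_boot.
From mathcomp Require Import boolp classical_sets functions cardinality.
From mathcomp Require Import zify_ssreflect.
From Stdlib Require Import Lia.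

(** Order-preserving maps of the zig-zag are the lazy walks on N that move by
    at most 1 and move from a point only when the current value has the parity
    of that point.  Given such an alpha, the number of moves made before x,
    shifted by an offset k, is a nondecreasing walk, hence lies in Theta; its
    parity is that of alpha when k has the parity of alpha(1), so it preserves
    the order.  The second factor retraces the moves of alpha without pauses
    from position k on (climbing forever once alpha has stopped), and before k
    climbs from a large value and then descends to alpha(1).  The climb gives
    injectivity on the first n points, the turning point gives
    non-injectivity. *)

Definition posnat_of (i : nat) : posnat := exist (fun n => 0 < n) i.+1 isT.

Definition map_of (f : nat -> nat) (x : posnat) : posnat :=
  posnat_of (f (val x).-1).

(* Positions and values are both shifted by one, so parities still match. *)
Definition nat_map (alpha : posnat -> posnat) (i : nat) : nat :=
  (val (alpha (posnat_of i))).-1.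

Definition adjacent (a b : nat) : Prop := b = a.+1 \/ a = b.+1.

Definition lazy_walk (f : nat -> nat) : Prop :=
  forall i, f i.+1 = f i \/ (odd (f i) = odd i /\ adjacent (f i) (f i.+1)).

Lemma adjacent_neq (a b : nat) : adjacent a b -> a <> b.
Proof. by rewrite /adjacent; lia. Qed.

Lemma adjacent_odd (a b : nat) : adjacent a b -> odd b = ~~ odd a.
Proof. by case=> -> /=; rewrite ?negbK. Qed.

Lemma posnat_eq (x y : posnat) : val x = val y -> x = y.
Proof. exact: val_inj. Qed.

Lemma posnat_ofK (x : posnat) : posnat_of (val x).-1 = x.
Proof. by apply: posnat_eq; case: x => -[]. Qed.

Lemma posnatS_of (i : nat) : posnatS (posnat_of i) = posnat_of i.+1.
Proof. exact: posnat_eq. Qed.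

Lemma nat_mapK (alpha : posnat -> posnat) : map_of (nat_map alpha) = alpha.
Proof.
by apply/funext => x; rewrite /map_of /nat_map !posnat_ofK.
Qed.

Lemma zz_ltP (x y : posnat) :
  zz_lt x y <-> odd (val x) /\ adjacent (val x) (val y).
Proof.
split=> [[m om|m om]|[ox [e|e]]].
- by split=> //; left.
- by split; [exact: om | right].
- by rewrite (posnat_eq y (posnatS x) e); constructor.
- rewrite (posnat_eq x (posnatS y) e); constructor.
  by move: ox; rewrite e.
Qed.

(** Distinct comparable points are neighbours, the one of even shifted index being the smaller, so a
    move of [f] must send even to even and odd to odd. *)
Lemma FN_map_of (f : nat -> nat) : FN (map_of f) <-> lazy_walk f.
Proof.
split=> [Ff i|Lf x y].
- have step u v : zz_lt (posnat_of u) (posnat_of v) ->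
      f u = f v \/ (~~ odd (f u) /\ adjacent (f u) (f v)).
    move=> luv.
    have [/(congr1 val) [] ->|/zz_ltP /= [o a]] := Ff _ _ (or_intror luv).
      by left.
    by right; split=> //; move: a; rewrite /adjacent; lia.
  have [oi|oi] := boolP (odd i).
  + have : zz_lt (posnat_of i.+1) (posnat_of i).
      by apply/zz_ltP; split; rewrite /= ?oi //; right.
    by move/step; rewrite /adjacent; lia.
  + have : zz_lt (posnat_of i) (posnat_of i.+1).
      by apply/zz_ltP; split; rewrite /= ?oi //; left.
    by move/step; rewrite /adjacent; lia.
- case=> [->|]; first by left.
  rewrite -(posnat_ofK x) -(posnat_ofK y).
  move: (_.-1) (_.-1) => v u /zz_ltP /= [ou [[->]|[e]]]; rewrite /map_of /=.
  + case: (Lf u) => [->|[o a]]; first by left.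
    by right; apply/zz_ltP => /=; move: a; rewrite /adjacent; lia.
  + rewrite e in ou *; case: (Lf v) => [->|[o a]]; first by left.
    by right; apply/zz_ltP => /=; move: a; rewrite /adjacent; lia.
Qed.

Lemma FN_rcomp (alpha beta : posnat -> posnat) :
  FN alpha -> FN beta -> FN (rcomp alpha beta).
Proof. by move=> Fa Fb x y /Fa /Fb. Qed.

Fixpoint moves (f : nat -> nat) (i : nat) : nat :=
  if i is j.+1 then moves f j + (f j.+1 != f j) else 0.

Lemma moves_homo (f : nat -> nat) : {homo moves f : i j / i <= j}.
Proof. by apply: homo_leq leqnn leq_trans _ => i /=; lia. Qed.

(** The count is monotone and grows at every change of [f], so equal counts leave [f] constant in
    between. *)
Lemma moves_inj (f : nat -> nat) (i j : nat) :
  moves f i = moves f j -> f i = f j.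
Proof.
wlog le_ij : i j / i <= j => [hw|].
  by case: (leqP i j) => [/hw//|/ltnW/hw h /esym/h].
elim: j le_ij => [|j IHj]; first by rewrite leqn0 => /eqP->.
rewrite leq_eqVlt => /orP[/eqP->//|le_ij] /= e.
have := moves_homo f i j le_ij; case: eqP e => [-> e _|/= _]; last by lia.
by apply: IHj => //; lia.
Qed.

Lemma odd_moves (f : nat -> nat) (i : nat) :
  lazy_walk f -> odd (moves f i) = odd (f i) (+) odd (f 0).
Proof.
move=> Lf; elim: i => [|i IHi] /=; first by rewrite addbb.
case: eqP (Lf i) => [->|ne] /= L; first by rewrite addn0.
by case: L => [//|[_ /adjacent_odd ->]]; rewrite addn1 /= IHi addNb.
Qed.

(** The count starts at 0 and rises by at most 1, so it skips no value. *)
Lemma moves_pred (f : nat -> nat) (i j : nat) :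
  moves f i = j.+1 -> exists m, moves f m = j /\ moves f m.+1 = j.+1.
Proof.
elim: i => //= i IHi e.
have [/IHi//|ne] := eqVneq (moves f i) j.+1.
by exists i => /=; lia.
Qed.

(* The walk [f] with its pauses deleted; it climbs once [f] has stopped. *)
Fixpoint trace (f : nat -> nat) (j : nat) : nat :=
  if pselect (exists i, moves f i = j) is left e then f (projT1 (cid e))
  else if j is j'.+1 then (trace f j').+1 else 0.

(** The index picked by choice may differ from [i], but [moves_inj] gives it the same value of
    [f]. *)
Lemma trace_moves (f : nat -> nat) (i : nat) : trace f (moves f i) = f i.
Proof.
have [j e] : exists j, j = moves f i by exists (moves f i).
rewrite -e; case: j e => [|j] e /=.
all: case: pselect => [h|[]]; last by exists i.
all: by case: (cid h) => m /= em; apply: moves_inj; rewrite em.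
Qed.

Lemma trace_step (f : nat -> nat) (j : nat) :
  lazy_walk f -> adjacent (trace f j) (trace f j.+1).
Proof.
move=> Lf; have [[i /moves_pred [m [<- e]]]|none] :=
  pselect (exists i, moves f i = j.+1).
- rewrite trace_moves -e trace_moves.
  by case: (Lf m) e => [/= ->|[]//]; rewrite eqxx; lia.
- by left=> /=; case: pselect.
Qed.

(* The starting value [2 (N + f 0)] is even, so that the walk keeps the parity
   of its position; after the peak at [N] it reaches [f 0] at [4 N + f 0]. *)
Definition lead_in (N : nat) (f : nat -> nat) (i : nat) : nat :=
  if i <= N then N.*2 + (f 0).*2 + i
  else if i <= 4 * N + f 0 then 4 * N + (f 0).*2 - i
  else trace f (i - (4 * N + f 0)).

Lemma lead_in_trace (N : nat) (f : nat -> nat) (j : nat) :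
  0 < N -> lead_in N f (4 * N + f 0 + j) = trace f j.
Proof.
move=> N0; have t0 : trace f 0 = f 0 := trace_moves f 0.
rewrite /lead_in; case: leqP => [|_]; first lia.
(* At the junction [j = 0] the descent formula still applies and yields [f 0]. *)
by case: leqP => h; [have -> : j = 0 by lia | congr trace]; lia.
Qed.

Lemma lead_in_rise (N : nat) (f : nat -> nat) (i : nat) :
  i <= N -> lead_in N f i = N.*2 + (f 0).*2 + i.
Proof. by rewrite /lead_in => ->. Qed.

(** Rise and descent are symmetric about the peak. *)
Lemma lead_in_turn (N : nat) (f : nat -> nat) :
  0 < N -> lead_in N f N.+1 = lead_in N f N.-1.
Proof. by rewrite /lead_in => N0; do !case: leqP => ?; lia. Qed.

Lemma lead_in_step (N : nat) (f : nat -> nat) (i : nat) :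
  0 < N -> lazy_walk f -> adjacent (lead_in N f i) (lead_in N f i.+1).
Proof.
move=> N0 Lf; have [le_ki|lt_ik] := leqP (4 * N + f 0) i.
  by rewrite -(subnKC le_ki) -addnS !lead_in_trace //; apply: trace_step.
by rewrite /lead_in /adjacent; do !case: leqP => ?; lia.
Qed.

Lemma odd_lead_in (N : nat) (f : nat -> nat) (i : nat) :
  0 < N -> lazy_walk f -> odd (lead_in N f i) = odd i.
Proof.
move=> N0 Lf; elim: i => [|i IHi].
  by rewrite lead_in_rise // addn0 oddD !odd_double.
by rewrite (adjacent_odd _ _ (lead_in_step N f i N0 Lf)) IHi.
Qed.

(** The offset is the position where [lead_in] reaches [f 0]; its parity cancels the term
    [odd (f 0)] of [odd_moves]. *)
Definition pace (N : nat) (f : nat -> nat) (i : nat) : nat :=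
  4 * N + f 0 + moves f i.

Lemma odd_pace (N : nat) (f : nat -> nat) (i : nat) :
  lazy_walk f -> odd (pace N f i) = odd (f i).
Proof.
by move=> Lf; rewrite /pace -addnA oddD oddM /= oddD odd_moves // addbC addbK.
Qed.

Lemma pace_Theta (N : nat) (f : nat -> nat) :
  lazy_walk f -> Theta (map_of (pace N f)).
Proof.
move=> Lf; split=> [|a [x _ ax]].
- apply/FN_map_of => i; rewrite odd_pace // /pace /=.
  have [->|[o _]] := Lf i; first by left; rewrite eqxx addn0.
  case: eqP => _ /=; first by left; rewrite addn0.
  by right; split=> //; left; rewrite !addnA addn1.
- split=> [|{ax}x y z ex ez /andP[xy yz]]; first by exists x.
  (* Monotonicity squeezes the value at [y] between two equal ones. *)
  have h (u v : posnat) : val u <= val v ->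
      val (map_of (pace N f) u) <= val (map_of (pace N f) v).
    move=> uv; rewrite /= /pace ltnS leq_add2l.
    by apply: moves_homo; rewrite -!subn1 leq_sub2r.
  apply: posnat_eq; apply/eqP; rewrite eqn_leq.
  by move: (h _ _ xy) (h _ _ yz); rewrite ex ez => -> ->.
Qed.

Lemma card_ge2 (T : Type) (A : set T) (x y : T) :
  A x -> A y -> x <> y -> (`I_2 #<= A)%card.
Proof.
move=> Ax Ay xy; pose h (i : nat) := if i is 0 then x else y.
have hI : {in `I_2 &, injective h}.
  move=> [|[|?]] [|[|?]]; rewrite !inE //= => _ _ e //; by case: xy.
apply: (@card_le_trans _ _ _ (image `I_2 h)).
  by have := inj_card_eq hI; rewrite card_eq_le => /andP[].
by apply: subset_card_le => _ [[|i] _ <-].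
Qed.

Lemma lead_in_Lambda (n : posnat) (f : nat -> nat) :
  lazy_walk f -> Lambda n (map_of (lead_in (val n) f)).
Proof.
move=> Lf; have n0 : 0 < val n := valP n.
split.
- apply/FN_map_of => i; right.
  by split; [exact: odd_lead_in | exact: lead_in_step].
- rewrite II0 card_eq0; apply/eqP; rewrite -subset0 => x /=.
  rewrite /nb /= -(posnat_ofK x) posnatS_of => /(congr1 val) /= [].
  by apply: adjacent_neq; apply: lead_in_step.
- rewrite II0 card_le0; apply/set0P.
  (* The points just before and just after the peak share a fibre. *)
  pose x := posnat_of (val n).-1; exists x.
  exists (map_of (lead_in (val n) f) x) => //=; split; first by exists x.
  apply: (card_ge2 _ _ x (posnat_of (val n).+1)) => //.
  + by apply: posnat_eq; rewrite /= lead_in_turn.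
  + move/(congr1 val) => /= [] /eqP.
    by rewrite ltn_eqF // (leq_ltn_trans (leq_pred _)).
- by rewrite /= lead_in_rise // -addnn -!addnA addn0 -addnS leq_addr.
(* The shifted indices of the segment are below [val n], hence on the rise, where the walk is
   injective. *)
- have -> : image (initseg n) (map_of (lead_in (val n) f)) =
      image `I_(val n) (fun i => map_of (lead_in (val n) f) (posnat_of i)).
    apply/seteqP; split=> _ [x xn <-].
      exists (val x).-1; last by rewrite posnat_ofK.
      by move: (valP x) xn; rewrite /initseg /=; lia.
    by exists (posnat_of x).
  apply: inj_card_eq => i j; rewrite !inE /= => ltin ltjn /(congr1 val) /= [].
  by rewrite !lead_in_rise; lia.
Qed.

Theorem proposition2p2 (n : posnat) : FN = setprod Theta (Lambda n).
Proof.
apply/seteqP; split=> [alpha|_ [alpha [Fa _]] [beta [Fb _ _ _ _] <-]]; last first.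
  exact: FN_rcomp.
rewrite -(nat_mapK alpha) => /FN_map_of; move: (nat_map alpha) => f Lf.
exists (map_of (pace (val n) f)); first exact: pace_Theta.
exists (map_of (lead_in (val n) f)); first exact: lead_in_Lambda.
apply/funext => x; apply: posnat_eq => /=.
(* [pace] lands past the lead-in, at the point of the trace indexed by the number of moves made so
   far. *)
by rewrite lead_in_trace ?trace_moves //; exact: (valP n).
Qed.
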